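(* Let $n\ge 2$ and let $A=(A_1,\dots,A_n)$ be a tuple of $k\times k$ complex matrices. Then $A$ is irreducible if and only if there exists a matrix $B\in\mathfrak{A}(A)$ such that, for the algebraic extension $\widetilde{A}=(A_1,\dots,A_n,B)$, the polynomial $$Q_{\widetilde{A}}(z_0,z_1,\dots,z_{n+1})=\det\big(z_0I+z_1A_1+\cdots+z_nA_n+z_{n+1}B\big)$$ is irreducible in $\mathbb{C}[z_0,\dots,z_{n+1}]$.
   Context: $\mathfrak{A}(A)$ denotes the unital subalgebra of $M_k(\mathbb{C})$ generated by $I,A_1,\dots,A_n$. A tuple is irreducible if its matrices have no common invariant subspace other than $0$ and $\mathbb{C}^k$. A tuple $(A_1,\dots,A_N)$ with $N>n$ and $A_{n+1},\dots,A_N\in\mathfrak{A}(A)$ is called an algebraic extension of $A$. *)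

(* Defs.v *)
From HB Require Import structures.
From mathcomp Require Import all_boot all_order all_algebra all_field.
From mathcomp Require Import reals complex.
From mathcomp Require Import mpoly.

Set Implicit Arguments.
Unset Strict Implicit.
Unset Printing Implicit Defensive.

Import GRing.Theory.
Local Open Scope ring_scope.
Local Open Scope complex_scope.

(* [agenv] always contains the identity, so no [1] has to be adjoined. *)
Definition generated_algebra (R : realType) (k n : nat)
    (A : n.-tuple 'M[R[i]]_k.+1) : {vspace 'M[R[i]]_k.+1} :=
  agenv <<A>>%VS.

(* Matrices act on column vectors from the left; subspaces of C^k are taken in
   ['cV_k.+1] because [stablemx] uses the row-vector convention. *)
Definition irreducible_tuple (R : realType) (k n : nat)
    (A : n.-tuple 'M[R[i]]_k.+1) : Prop :=
  forall U : {vspace 'cV[R[i]]_k.+1},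
    (forall (i : 'I_n) (v : 'cV[R[i]]_k.+1), v \in U -> tnth A i *m v \in U) ->
    U = 0%VS \/ U = fullv.

(* The variable z_0 is ['X_ord0] and z_(i+1) is ['X_(lift ord0 i)], paired with
   the i-th entry of the tuple (numbered from 0). *)
Definition pencil_det (R : realType) (k m : nat)
    (A : m.-tuple 'M[R[i]]_k.+1) : {mpoly R[i][m.+1]} :=
  \det ('X_ord0 *: 1%:M
        + \sum_(i < m)
            'X_(lift ord0 i) *: map_mx (@mpolyC m.+1 R[i]) (tnth A i)).

Definition irreducible_elt (D : idomainType) (p : D) : Prop :=
  [/\ p != 0,
      p \isn't a GRing.unit
    & forall a b : D, p = a * b ->
        a \is a GRing.unit \/ b \is a GRing.unit].

(* Main.v *)
(* An invariant subspace makes the pencil block triangular, so its determinant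
   factors, and neither factor is a unit since both vanish at 0.  Conversely,
   if the tuple is irreducible, Burnside's theorem makes every matrix B
   available.  For k > 0 pick a non-scalar A_i and a basis in which its corner entry (0,k)
   is nonzero, and let B be the nilpotent shift J in that basis.  Setting
   z_i = x, z_(n+1) = 1 and the other z_j = 0 turns the determinant into
   det (z_0 + x A_i + B), which is z_0^(k+1) at x = 0 and whose constant
   coefficient det (x A_i + B) has a simple zero at x = 0: it is irreducible by
   Eisenstein's criterion at x.  Because the determinant has total degree k+1
   and stays monic of degree k+1 in z_0, a constant specialised factor comes
   from a constant factor. *)
Require Import Defs.
From HB Require Import structures.
From mathcomp Require Import all_boot all_order all_fingroup all_algebra all_field.
From mathcomp Require Import reals complex.
From mathcomp Require Import mpoly zify.

Import GRing.Theory.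
Local Open Scope ring_scope.
Local Open Scope complex_scope.

(** * Burnside's theorem for irreducible matrix algebras *)

Lemma exists_rank_sub_scalar_lt (C : closedFieldType) n (X : 'M[C]_n) :
  (0 < n)%N -> exists a, (\rank (X - a%:M)%R < n)%N.
Proof.
case: n X => // n X _.
have [|a] := closed_rootP (char_poly X) _; first by rewrite size_char_poly.
rewrite -eigenvalue_root_char => aX; exists a.
rewrite ltn_neqAle rank_leq_row andbT; apply: contraTneq aX => rX.
by rewrite /eigenvalue /eigenspace kermx_eq0 /row_free rX eqxx.
Qed.

Section Burnside.
Variables (C : closedFieldType) (k : nat) (U : {aspace 'M[C]_k.+1}).
Hypothesis U1 : 1 \in U.
Hypothesis irrU : forall V : {vspace 'cV[C]_k.+1},
  (forall X v, X \in U -> v \in V -> X *m v \in V) -> V = 0%VS \/ V = fullv.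

Lemma irreducible_cyclic (x y : 'cV[C]_k.+1) :
  x != 0 -> exists2 X, X \in U & X *m x = y.
Proof.
move=> xN0.
have [X v XU /memv_imgP[Y YU ->]||E] :=
  irrU (linfun (mulmxr x : 'M[C]_k.+1 -> 'cV_k.+1) @: U)%VS.
- rewrite lfunE /= mulmxA; apply/memv_imgP; exists (X * Y); last by rewrite lfunE.
  exact: memvM.
- move=> E; case/negP: xN0; rewrite -memv0 -E; apply/memv_imgP.
  by exists 1; rewrite ?lfunE /= ?mul1mx.
have : y \in fullv by apply: memvf.
by rewrite -E => /memv_imgP[X XU ->]; exists X => //; rewrite lfunE.
Qed.

(* The columns killed by all rows [f *m X], X in the algebra, form an
   invariant subspace. *)
Lemma irreducible_cocyclic (f g : 'rV[C]_k.+1) :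
  f != 0 -> exists2 X, X \in U & f *m X = g.
Proof.
move=> fN0.
(* The rows of [W] span the orbit of [f]. If the kernel is 0, every row [g] lies in that span; if it
   is everything, then [W = 0] and hence [f = 0]. *)
pose W : 'M_(\dim U, k.+1) := \matrix_i (f *m (vbasis U)`_i).
have WP X : X \in U -> exists c : 'rV_(\dim U), f *m X = c *m W.
  move=> /coord_vbasis E; exists (\row_i coord (vbasis U) i X).
  rewrite [RHS]mulmx_sum_row [in LHS]E mulmx_sumr; apply: eq_bigr => i _.
  by rewrite mxE rowK -scalemxAr.
have [X v XU||E] := irrU (lker (linfun (mulmx W : 'cV_k.+1 -> _))).
- rewrite !memv_ker !lfunE /= => /eqP Wv0; apply/eqP/row_matrixP => i.
  rewrite mulmxA !row_mul rowK -mulmxA row0.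
  have bU : (vbasis U)`_i \in U by rewrite vbasis_mem // mem_nth // size_tuple.
  have [c Ec] := WP _ (memvM bU XU).
  by rewrite !mulmxA -(mulmxA f) Ec -mulmxA Wv0 mulmx0.
- move=> E.
  have : row_full W.
    rewrite -cokermx_eq0; apply/eqP/matrixP => i j.
    have : col j (cokermx W) \in lker (linfun (mulmx W : 'cV_k.+1 -> _)).
      by rewrite memv_ker lfunE /= colE mulmxA mulmx_coker mul0mx.
    by rewrite E memv0 => /eqP/colP/(_ i); rewrite !mxE.
  move=> /(submx_full g)/submxP[c ->].
  exists (\sum_i c 0 i *: (vbasis U)`_i).
    by apply: memv_suml => i _; rewrite memvZ // vbasis_mem // mem_nth // size_tuple.
  rewrite mulmx_sumr [RHS]mulmx_sum_row; apply: eq_bigr => i _.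
  by rewrite rowK -scalemxAr.
have : W = 0.
  apply/matrixP => i j.
  have : delta_mx j 0 \in lker (linfun (mulmx W : 'cV_k.+1 -> _)) by rewrite E memvf.
  by rewrite memv_ker lfunE /= -colE => /eqP/colP/(_ i); rewrite !mxE.
have [c Ec] := WP 1 U1.
by move=> W0; move: Ec; rewrite W0 mulmx0 mulmx1 => f0; rewrite f0 eqxx in fN0.
Qed.

(* If T has minimal rank among the nonzero elements, then T X T = a T for every
   X and a suitable scalar a; this fails as soon as T has two independent
   columns. *)
Lemma irreducible_rank_one :
  exists2 x : 'cV[C]_k.+1, x != 0 & exists2 f : 'rV_k.+1, f != 0 & x *m f \in U.
Proof.
suff: forall r T, \rank T = r -> T != 0 -> T \in U ->
  exists2 x : 'cV[C]_k.+1, x != 0 & exists2 f : 'rV_k.+1, f != 0 & x *m f \in U.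
  by move/(_ _ 1 erefl); apply; rewrite ?oner_neq0.
elim/ltn_ind => r IH T rT TN0 TU.
have [j] : exists j, col j T != 0.
  apply/existsP; apply: contraNT TN0 => /existsPn T0.
  apply/eqP/matrixP => i j; move/eqP/colP/(_ i): (negbNE (T0 j)).
  by rewrite !mxE.
rewrite colE; set e := delta_mx j 0 => TeN0.
(* If every column of [T] is a multiple of [T *m e], then [T] already has rank one. *)
have [/forallP par|/forallPn[l nl]] :=
  boolP [forall l, (col l T)^T <= (T *m e)^T]%MS.
  exists (T *m e) => //.
  have /submxP[c Ec] : (T^T <= (T *m e)^T)%MS.
    by apply/row_subP => l; rewrite -tr_col par.
  have ET : T = T *m e *m c^T by apply: trmx_inj; rewrite Ec [RHS]trmx_mul trmxK.
  exists c^T; last by rewrite -ET.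
  by apply: contraNneq TN0 => c0; rewrite ET c0 mulmx0.
have [X XU EX] := irreducible_cyclic _ (delta_mx l 0) TeN0.
(* With [T = L *m R], taking for [a] an eigenvalue of the square matrix [R *m X *m L] of size
   [\rank T] makes the rank of [S] drop. *)
pose L := col_base T; pose R := row_base T.
have rT0 : (0 < \rank T)%N by rewrite lt0n mxrank_eq0.
have [a ra] := exists_rank_sub_scalar_lt _ _ (R *m X *m L) rT0.
pose S := T *m X *m T - a *: T.
have ES : S = L *m (R *m X *m L - a%:M) *m R.
  rewrite /S mulmxBr mulmxBl mul_mx_scalar -scalemxAl.
  by rewrite -[in LHS](mulmx_base T) -/L -/R !mulmxA.
apply: (IH (\rank S) _ S) => //.
- rewrite -rT ES; apply: leq_ltn_trans (mxrankM_maxl _ _) _.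
  exact: leq_ltn_trans (mxrankM_maxr _ _) _.
(* Since [X] sends [T *m e] to the [l]-th unit vector, [S *m e = 0] would make column [l] of [T] a
   multiple of [T *m e]. *)
- apply: contraNneq nl => S0; rewrite colE -EX.
  have : S *m e = 0 by rewrite S0 mul0mx.
  rewrite /S mulmxBl => /eqP; rewrite subr_eq0 -!mulmxA => /eqP ->.
  by rewrite -scalemxAl linearZ /= scalemx_sub.
- by rewrite memvB ?memvZ //; apply: (memvM (memvM TU XU) TU).
Qed.

(** The rank-one element [x *m f] can be carried to each matrix unit: [Y] moves [x] to the [i]-th
    unit column and [Z] moves [f] to the [j]-th unit row. *)
Lemma burnside X : X \in U.
Proof.
have [x xN0 [f fN0 xfU]] := irreducible_rank_one.
rewrite [X]matrix_sum_delta; apply: memv_suml => i _; apply: memv_suml => j _.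
rewrite memvZ //.
have [Y YU Yx] := irreducible_cyclic _ (delta_mx i 0) xN0.
have [Z ZU fZ] := irreducible_cocyclic _ (delta_mx 0 j) fN0.
rewrite -(mul_delta_mx (0 : 'I_1)) -Yx -fZ.
by have := memvM (memvM YU xfU) ZU; rewrite /= -!mulmxE !mulmxA.
Qed.

End Burnside.

(** * Conjugating a non-scalar matrix to get a nonzero corner entry *)

(** Only a diagonal [M] with some [M i i != M 0 0] needs work: conjugating by the transvection
    [1%:M + delta_mx i 0] puts [M 0 0 - M i i] at position (i, 0). *)
Lemma nonscalar_conj_entry (F : fieldType) n (M : 'M[F]_n.+1) :
  ~~ is_scalar_mx M ->
  exists2 P, P \in unitmx & exists i j, i != j /\ (P *m M *m invmx P) i j != 0.
Proof.
move=> nscM.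
have [/existsP[i /existsP[j /andP[ij Mij]]]|/existsPn diagM] :=
  boolP [exists i, [exists j, (i != j) && (M i j != 0)]].
  by exists 1%:M; [exact: unitmx1 | exists i, j; rewrite invmx1 mulmx1 mul1mx].
have M0 i j : i != j -> M i j = 0.
  by move=> ij; have /existsPn/(_ j) := diagM i; rewrite ij /= negbK => /eqP.
have [i Mi] : exists i, M i i != M 0 0.
  apply/existsP; apply: contraNT nscM => /existsPn E.
  apply/is_scalar_mxP; exists (M 0 0); apply/matrixP => i j; rewrite !mxE.
  have [->|ij] := eqVneq i j; last by rewrite (M0 _ _ ij).
  by rewrite (eqP (negbNE (E j))) mulr1n.
have i0 : i != 0 by apply: contraNneq Mi => ->.
pose D : 'M[F]_n.+1 := delta_mx i 0.
have DD : D *m D = 0 by rewrite /D mul_delta_mx_0 // eq_sym.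
have PQ : (1%:M + D) *m (1%:M - D) = 1%:M.
  by rewrite mulmxDl !mulmxBr DD !mul1mx mulmx1 subr0 subrK.
have [Pu EP] := mulmx1_unit PQ.
exists (1%:M + D) => //; exists i, 0; split=> //.
have -> : invmx (1%:M + D) = 1%:M - D.
  by rewrite -[LHS]mulmx1 -[X in _ *m X]PQ mulKmx.
rewrite mulmxBr mulmx1 mulmxDl mul1mx mulmxDl.
have E1 : (D *m M) i 0 = M 0 0.
  rewrite !mxE (bigD1 0) //= big1 ?addr0 ?mxE ?eqxx ?mul1r // => l l0.
  by rewrite !mxE (negPf l0) andbF mul0r.
have E2 : (M *m D) i 0 = M i i.
  rewrite !mxE (bigD1 i) //= big1 ?addr0 ?mxE ?eqxx ?mulr1 // => l li.
  by rewrite !mxE (negPf li) mulr0.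
have E3 : (D *m M *m D) i 0 = 0.
  rewrite !mxE big1 // => l _; rewrite [D l 0]mxE.
  case: (eqVneq l i) => [->|]; last by rewrite mulr0.
  rewrite !mxE big1 ?mul0r // => m _; rewrite !mxE eqxx /=.
  by case: eqP => [->|]; rewrite ?mul0r // M0 ?mulr0 // eq_sym.
move: (M *m D) E2 (D *m M) E1 (D *m M *m D) E3 => X2 E2 X1 E1 X3 E3.
by rewrite !mxE E1 E2 E3 (M0 _ _ i0) add0r addr0 subr_eq0 eq_sym.
Qed.

Lemma nonscalar_conj_corner (F : fieldType) n (M : 'M[F]_n.+1) :
  ~~ is_scalar_mx M ->
  exists2 P, P \in unitmx & (P *m M *m invmx P) ord0 ord_max != 0.
Proof.
move=> /nonscalar_conj_entry[P Pu [i [j [ij Nij]]]].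
have n0 : ord0 != ord_max :> 'I_n.+1.
  apply: contraNneq ij => /(congr1 val)/= n0; apply/eqP/val_inj => /=.
  by move: (ltn_ord i) (ltn_ord j); lia.
(* [s] sends [ord0] to [i] and [ord_max] to [j]; the inner [tperm] accounts for the first swap
   possibly moving [ord_max]. *)
pose s := (tperm ord0 i * tperm (tperm ord0 i ord_max) j)%g.
have s0 : s ord0 = i.
  rewrite permM tpermL tpermD // 1?eq_sym //.
  by rewrite -[X in X != _](tpermL ord0 i) (inj_eq perm_inj).
have sm : s ord_max = j by rewrite permM tpermL.
exists (perm_mx s *m P); first by rewrite unitmx_mul unitmx_perm.
have -> : invmx (perm_mx s *m P) = invmx P *m perm_mx s^-1.
  have u : perm_mx s *m P \in unitmx by rewrite unitmx_mul unitmx_perm.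
  apply: (can_inj (mulKmx u)); rewrite mulmxV // mulmxA mulmxK //.
  by rewrite -perm_mxM mulgV perm_mx1.
have -> : perm_mx s *m P *m M *m (invmx P *m perm_mx s^-1) =
    col_perm s (row_perm s (P *m M *m invmx P)).
  by rewrite col_permE row_permE !mulmxA.
by move: (P *m M *m invmx P) Nij => X Nij; rewrite !mxE s0 sm.
Qed.

(** * The shift pencil, and invariance under conjugation *)

Definition shift_mx (F : pzRingType) n : 'M[F]_n.+1 :=
  \matrix_(i, j) ((i : nat) == j.+1)%:R.

(* Row 0 of the pencil is ['X] times row 0 of [M]; at 0 the remaining minor is
   the identity. *)
Lemma det_shift_pencil (F : comNzRingType) n (M : 'M[F]_n.+1) :
  exists2 g : {poly F},
    \det ('X *: map_mx polyC M + map_mx polyC (shift_mx F n)) = 'X * g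
    & g.[0] = M ord0 ord_max * (-1) ^+ n.
Proof.
pose G : 'M[{poly F}]_n.+1 := \matrix_(i, j)
  if i == ord0 then (M i j)%:P else 'X * (M i j)%:P + (shift_mx F n i j)%:P.
exists (\det G).
  (* Multilinearity in row 0, with coefficients ['X] and 0, pulls ['X] out of the determinant. *)
  rewrite (@determinant_multilinear _ _ _ G G 0 'X 0) ?mul0r ?addr0 //.
  - apply/rowP => j; rewrite !mxE eqxx /= addrC.
    by rewrite mulr0n polyC0 mul0r add0r addr0.
  - by apply/matrixP => i j; rewrite !mxE.
  - by apply/matrixP => i j; rewrite !mxE.
pose G0 := map_mx (horner_eval 0) G.
have -> : (\det G).[0] = \det G0 by rewrite det_map_mx.
have G0E i j : G0 i j = if i == ord0 then M i j else ((i : nat) == j.+1)%:R.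
  rewrite !mxE /horner_eval; case: eqP => _; first by rewrite hornerC.
  by rewrite hornerD hornerM hornerX mul0r add0r hornerC.
rewrite (expand_det_col _ ord_max) (bigD1 ord0) //= [X in _ + X]big1 ?addr0.
  rewrite G0E eqxx /cofactor add0n.
  suff -> : row' ord0 (col' ord_max G0) = 1%:M by rewrite det1 mulr1.
  apply/matrixP => i j; rewrite 2![LHS]mxE G0E [RHS]mxE.
  by rewrite lift0 lift_max eqSS.
by move=> i i0; rewrite G0E (negPf i0) ltn_eqF ?mul0r //.
Qed.

(** Two size parameters are kept because an adapted block basis has size [\dim U + e], equal to [N]
    only by a proof. *)
Lemma det_conj (F : comNzRingType) n m (P : 'M[F]_(m, n)) (Q : 'M_(n, m)) X :
  n = m -> P *m Q = 1%:M -> \det (P *m X *m Q) = \det X.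
Proof.
move=> nm; subst m => PQ.
by rewrite !det_mulmx mulrAC -det_mulmx PQ det1 mul1r.
Qed.

Lemma char_poly_conj (F : comNzRingType) n (X P Q : 'M[F]_n) :
  P *m Q = 1%:M -> char_poly (P *m X *m Q) = char_poly X.
Proof.
move=> PQ; rewrite /char_poly /char_poly_mx !map_mxM.
have := congr1 (map_mx polyC) PQ; rewrite map_mxM map_mx1.
move: (map_mx _ P) (map_mx _ Q) (map_mx _ X) => p q x pq.
have -> : 'X%:M - p *m x *m q = p *m ('X%:M - x) *m q.
  by rewrite mulmxBr mulmxBl scalar_mxC -[_%:M *m _ *m _]mulmxA pq mulmx1.
exact: det_conj.
Qed.

(** * Eisenstein's criterion and degree bounds *)

(** Modulo the inner variable, a nonconstant factor divides a power of the outer one, so its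
    constant coefficient is divisible by ['X]. Two such factors would put ['X ^+ 2] in the constant
    coefficient of the product. *)
Lemma eisenstein_X (F : fieldType) (a b : {poly {poly F}}) N g :
  a * b \is monic -> map_poly (horner_eval 0) (a * b) = 'X^N ->
  (a * b)`_0 = 'X * g -> g.[0] != 0 ->
  size a = 1%N \/ size b = 1%N.
Proof.
have vanish (c d : {poly {poly F}}) : c * d \is monic ->
    map_poly (horner_eval 0) (c * d) = 'X^N -> size c != 1%N ->
    exists c', c`_0 = 'X * c'.
  move=> /monicP; rewrite lead_coefM => lcd Ecd sc.
  pose c0 := map_poly (horner_eval 0) c.
  (* The leading coefficients of [c] and [d] multiply to 1, so that of [c] survives evaluation at
     0. *)
  have sc0 : size c0 = size c.
    rewrite size_map_poly_id0 //; have := congr1 (horner^~ 0) lcd.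
    rewrite hornerM hornerC; apply: contra_eq_neq; rewrite /horner_eval => ->.
    by rewrite mul0r eq_sym oner_eq0.
  (* Otherwise [c0] is coprime to ['X^N], which it divides, and is therefore constant. *)
  have rc0 : root c0 0.
    apply: contraNT sc; rewrite -coprimep_XsubC subr0 -sc0 => /(coprimep_expr N).
    rewrite -Ecd rmorphM => /coprimepP/(_ c0 (dvdpp _)).
    by rewrite dvdp_mulr ?dvdpp // -size_poly_eq1 => ->.
  have : root c`_0 0.
    by move: rc0; rewrite /root !horner_coef0 coef_map /= /horner_eval horner_coef0.
  by rewrite -dvdp_XsubCl subr0 => /dvdpP[q ->]; exists q; rewrite mulrC.
move=> mab Eab ab0 g0.
have [->|sa] := eqVneq (size a) 1%N; first by left.
have [->|sb] := eqVneq (size b) 1%N; first by right.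
have [a' Ea] := vanish a b mab Eab sa.
have [b' Eb] : exists b', b`_0 = 'X * b' by apply: (vanish b a); rewrite // mulrC.
move: ab0; rewrite coef0M Ea Eb -mulrA => /(mulfI (negbT (polyX_eq0 _))) Eg.
by move: g0; rewrite -Eg mulrCA hornerM hornerX mul0r eqxx.
Qed.

(** A monomial of degree d becomes a constant times d polynomials of degree at most 1. This bounds
    the degree in z_0 of a specialised factor by its total degree. *)
Lemma size_mmap_le (C S : comNzRingType) m (f : C -> {poly S})
    (h : 'I_m -> {poly S}) (p : {mpoly C[m]}) :
  (forall c, size (f c) <= 1)%N -> (forall i, size (h i) <= 2)%N ->
  (size (mmap f h p) <= msize p)%N.
Proof.
move=> sf sh; rewrite /mmap big_seq.
apply: (big_ind (fun q : {poly S} => size q <= msize p)%N) => [|q r sq sr|u up].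
- by rewrite size_poly0.
- by apply: leq_trans (size_polyD _ _) _; rewrite geq_max sq.
apply: leq_trans (msize_mdeg_lt up); rewrite mdegE /mmap1.
have sM (q r : {poly S}) d e :
    (size q <= d.+1 -> size r <= e.+1 -> size (q * r)%R <= (d + e).+1)%N.
  by move=> sq sr; apply: leq_trans (size_polyMleq _ _) _; lia.
rewrite -[X in (_ <= X.+1)%N]add0n; apply: (sM) => //.
apply: (big_ind2 (fun (q : {poly S}) d => size q <= d.+1)%N) => [|q d r e|i _].
- by rewrite size_poly1.
- exact: (sM).
elim: (u i) => [|e IH]; first by rewrite expr0 size_poly1.
by rewrite exprS -[e.+1]add1n; apply: (sM).
Qed.

Lemma msize_det_le (C : idomainType) m N (X : 'M[{mpoly C[m]}]_N) :
  (forall i j, msize (X i j) <= 2)%N -> (msize (\det X) <= N.+1)%N.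
Proof.
move=> sX; rewrite /determinant.
apply: (big_ind (fun q : {mpoly C[m]} => msize q <= N.+1)%N) => [|q r sq sr|s _].
- by rewrite msize0.
- by apply: leq_trans (msizeD_le _ _) _; rewrite geq_max sq.
rewrite mulr_sign; set q := \prod_i _.
suff : (msize q <= N.+1)%N by case: ifP; rewrite ?msizeN.
rewrite -[X in (_ <= X.+1)%N]card_ord -sum1_card /q.
apply: (big_ind2 (fun (q : {mpoly C[m]}) d => msize q <= d.+1)%N) => [|p d r e sp sr|i _].
- by rewrite msize1.
- have [->|p0] := eqVneq p 0; first by rewrite mul0r msize0.
  have [->|r0] := eqVneq r 0; first by rewrite mulr0 msize0.
  by rewrite msizeM //; lia.
exact: sX.
Qed.

Lemma msize_XM_le (C : idomainType) m (l : 'I_m) (q : {mpoly C[m]}) :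
  (msize q <= 1 -> msize ('X_l * q)%R <= 2)%N.
Proof.
move=> sq; have [->|q0] := eqVneq q 0; first by rewrite mulr0 msize0.
by rewrite msizeM // ?msizeX ?mdeg1 // -msize_poly_eq0 msizeX.
Qed.

Lemma msize_le1_unit (C : fieldType) m (p : {mpoly C[m]}) :
  p != 0 -> (msize p <= 1)%N -> p \is a GRing.unit.
Proof.
move=> p0 /msize1_polyC Ep; move: p0; rewrite Ep mpolyC_eq0 => c0.
by apply/unitrP; exists (p@_0)^-1%:MP; rewrite -!mpolyCM mulVf ?mulfV.
Qed.

Lemma monic_mul_size (D : idomainType) (p q : {poly D}) :
  p * q \is monic -> (size p + size q = (size (p * q)%R).+1)%N.
Proof.
move=> /monic_neq0; rewrite mulf_eq0 negb_or => /andP[p0 q0].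
by rewrite size_mul // prednK // addn_gt0 size_poly_gt0 p0.
Qed.

(** * Irreducibility of the pencil determinant by specialisation *)

(** The matrix inside [pencil_det], for families of any size [N], so that it also covers diagonal
    blocks. *)
Definition pencil (C : comNzRingType) N m (A : 'I_m -> 'M[C]_N) :
    'M[{mpoly C[m.+1]}]_N :=
  'X_ord0 *: 1%:M + \sum_i 'X_(lift ord0 i) *: map_mx (@mpolyC m.+1 C) (A i).

Arguments pencil {C N m} A.

(** The pencil is the zero matrix at the origin; [0 < N] matters since an empty determinant is 1. *)
Lemma det_pencil_nonunit (C : fieldType) N m (A : 'I_m -> 'M[C]_N) :
  (0 < N)%N -> \det (pencil A) \isn't a GRing.unit.
Proof.
case: N A => // N A _; apply/negP => /(rmorph_unit (meval (fun=> 0))).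
rewrite -det_map_mx map_mxD map_mxZ raddf_sum /=.
rewrite mevalXU scale0r add0r big1 ?det0 ?unitr0 // => j _.
by rewrite map_mxZ /= mevalXU scale0r.
Qed.

Section PencilDet.
Variables (R : realType) (k m : nat) (A : m.-tuple 'M[R[i]]_k.+1).

Lemma msize_pencil_det_le : (msize (pencil_det A) <= k.+2)%N.
Proof.
apply: msize_det_le => i j; rewrite !mxE.
apply: leq_trans (msizeD_le _ _) _; rewrite geq_max; apply/andP; split.
  by apply: msize_XM_le; case: (i == j); rewrite ?msize1 ?msize0.
rewrite summxE.
apply: (big_ind (fun q : {mpoly R[i][m.+1]} => msize q <= 2)%N) => [|q r sq sr|l _].
- by rewrite msize0.
- by apply: leq_trans (msizeD_le _ _) _; rewrite geq_max sq.
by rewrite !mxE; apply: msize_XM_le; rewrite msizeC; case: (_ != _).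
Qed.

(** Putting [h j] for z_(j+1) specialises the determinant to [char_poly (- X)], to which
    Eisenstein's criterion applies; a degree count carries the conclusion back. *)
Lemma pencil_det_irreducible (h : 'I_m -> {poly R[i]}) (g : {poly R[i]})
    (X := \sum_j h j *: map_mx polyC (tnth A j)) :
  char_poly (map_mx (horner_eval 0) (- X)) = 'X^(k.+1) ->
  \det X = 'X * g -> g.[0] != 0 ->
  irreducible_elt (pencil_det A).
Proof.
move=> EX0 dX g0.
(* z_0 becomes the outer variable, and each [h l] a constant with respect to it. *)
pose h' j := if unlift ord0 j is Some l then (h l)%:P else 'X.
pose phi : {rmorphism {mpoly R[i][m.+1]} -> {poly {poly R[i]}}} :=
  mmap (polyC \o polyC) h'.
have Ephi : phi (pencil_det A) = char_poly (- X).
  rewrite /pencil_det -det_map_mx; congr (\det _).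
  rewrite map_mxD map_mxZ raddf_sum /= /char_poly_mx; congr (_ + _).
    by rewrite mmapX mmap1U /h' unlift_none map_mx1 scalemx1.
  rewrite map_mxN opprK raddf_sum; apply: eq_bigr => j _.
  rewrite map_mxZ [RHS]map_mxZ /= mmapX mmap1U /h' liftK; congr (_ *: _).
  by apply/matrixP => u v; rewrite !mxE /= mmapC.
have sphi p : (size (phi p) <= msize p)%N.
  apply: size_mmap_le => [c|j]; first by rewrite size_polyC leq_b1.
  rewrite /h'; case: unliftP => [l|] _; last by rewrite size_polyX.
  by rewrite size_polyC; case: (_ != _).
have mphi : phi (pencil_det A) \is monic by rewrite Ephi char_poly_monic.
have p0 : pencil_det A != 0.
  by apply: contraTneq mphi => ->; rewrite /phi raddf0 monicE lead_coef0 eq_sym oner_eq0.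
split=> //; first exact: det_pencil_nonunit.
move=> a b Eab.
have [a0 b0] : a != 0 /\ b != 0 by apply/andP; rewrite -negb_or -mulf_eq0 -Eab.
have szab : (size (phi a) + size (phi b))%N = k.+3.
  have -> : k.+3 = (size (phi a * phi b)).+1.
    by rewrite -rmorphM -Eab Ephi size_char_poly.
  by apply: monic_mul_size; rewrite -rmorphM -Eab.
have smab : (msize a + msize b <= k.+3)%N.
  by have := msize_pencil_det_le; rewrite Eab msizeM //; lia.
(* The specialised degrees add up to k+1, already the maximum for the total degrees, so neither
   factor loses degree. *)
have le1 (x y u v : nat) : (x + y = k.+3 -> u + v <= k.+3 -> x <= u -> y <= v ->
  (x = 1 -> u <= 1) /\ (y = 1 -> v <= 1))%N by lia.
have [sa sb] := le1 _ _ _ _ szab smab (sphi a) (sphi b).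
(* One sign comes from the constant coefficient of a characteristic polynomial, the other from
   [\det (- X)]; they cancel. *)
have [] := @eisenstein_X _ (phi a) (phi b) k.+1 ((-1) ^+ k.+1 * (-1) ^+ k.+1 * g).
- by rewrite -rmorphM -Eab.
- by rewrite -rmorphM -Eab Ephi map_char_poly EX0.
- rewrite -rmorphM -Eab Ephi char_poly_det -[Y in \det Y]scaleN1r detZ dX.
  by rewrite mulrA mulrCA !mulrA.
- by rewrite -expr2 sqrr_sign mul1r.
- by move=> /sa ?; left; apply: msize_le1_unit.
- by move=> /sb ?; right; apply: msize_le1_unit.
Qed.
End PencilDet.

(** * Invariant subspaces and the block factorisation *)

Lemma vspace_coord_mx (F : fieldType) N (U : {vspace 'cV[F]_N}) v :
  v \in U ->
  exists c, v = \matrix_(i < N, j < \dim U) (vbasis U)`_j i 0 *m c.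
Proof.
move=> /coord_vbasis Ev; exists (\col_j coord (vbasis U) j v).
apply/colP => i; rewrite {1}Ev summxE [RHS]mxE; apply: eq_bigr => j _.
by rewrite !mxE mulrC.
Qed.

(** The columns of [Q] are a basis of [U] followed by one of a complement, and [P] is its
    inverse. *)
Lemma vspace_block_basis (F : fieldType) N (U : {vspace 'cV[F]_N}) :
  exists e (P : 'M_(\dim U + e, N)) (Q : 'M_(N, \dim U + e)),
  [/\ N = (\dim U + e)%N, P *m Q = 1%:M
    & forall X : 'M_N, (forall v, v \in U -> X *m v \in U) ->
        dlsubmx (P *m X *m Q) = 0].
Proof.
pose W (V : {vspace 'cV[F]_N}) :=
  \matrix_(i < N, j < \dim V) (vbasis V)`_j i 0 : 'M[F]_(N, \dim V).
pose V := (U^C)%VS; exists (\dim V).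
have EN : N = (\dim U + \dim V)%N.
  by rewrite dimv_compl subnKC ?dimvS ?subvf // dimvf /dim /= muln1.
pose Q := row_mx (W U) (W V).
have : (1%:M <= Q^T)%MS.
  apply/row_subP => i; rewrite row1.
  have : (delta_mx 0 i)^T \in (U + V)%VS by rewrite addv_complf memvf.
  case/memv_addP=> u /vspace_coord_mx[c Ec] [v /vspace_coord_mx[d Ed] E].
  apply/submxP; exists (col_mx c d)^T.
  by rewrite -trmx_mul mul_row_col -Ec -Ed -E trmxK.
case/submxP=> D /(congr1 trmx); rewrite trmx_mul trmxK trmx1 => QD.
exists D^T, Q.
have PQ : D^T *m Q = 1%:M.
  have mulC1 a b (K : 'M[F]_(a, b)) L : a = b -> K *m L = 1%:M -> L *m K = 1%:M.
    by move=> ab; subst b; apply: mulmx1C.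
  exact: mulC1 EN (esym QD).
split=> // X stX; apply/row_matrixP => i; apply/rowP => j.
(* This is the lower left block of [P *m Q = 1%:M]. *)
have PU0 : dsubmx D^T *m W U = 0.
  have := congr1 dlsubmx PQ; rewrite -{1}[D^T]vsubmxK mul_col_row block_mxKdl.
  by rewrite scalar_mx_block block_mxKdl.
have -> : dlsubmx (D^T *m X *m Q) = dsubmx D^T *m (X *m W U).
  by rewrite -{1}[D^T]vsubmxK -mulmxA mul_mx_row mul_col_row block_mxKdl.
have [c Ec] : exists c, X *m col j (W U) = W U *m c.
  apply: vspace_coord_mx; apply: stX.
  have -> : col j (W U) = (vbasis U)`_j by apply/colP => l; rewrite !mxE.
  by rewrite vbasis_mem // mem_nth // size_tuple.
have : col j (dsubmx D^T *m (X *m W U)) = 0.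
  by rewrite colE -!mulmxA -[W U *m _]colE Ec mulmxA PU0 mul0mx.
by move=> /colP/(_ i); rewrite !mxE.
Qed.

(** One basis adapted to [U] makes all the [A i], and hence the pencil, block upper triangular. *)
Lemma det_pencil_stable (C : fieldType) N m (A : 'I_m -> 'M[C]_N)
    (U : {vspace 'cV[C]_N}) :
  (forall i v, v \in U -> A i *m v \in U) ->
  exists e (A1 : 'I_m -> 'M_(\dim U)) (A2 : 'I_m -> 'M_e),
    N = (\dim U + e)%N /\ \det (pencil A) = \det (pencil A1) * \det (pencil A2).
Proof.
move=> stA; have [e [P [Q [EN PQ st]]]] := vspace_block_basis _ _ U.
pose Y i := P *m A i *m Q.
exists e, (fun i => ulsubmx (Y i)), (fun i => drsubmx (Y i)); split=> //.
have PQ' : map_mx (@mpolyC m.+1 C) P *m map_mx (@mpolyC m.+1 C) Q = 1%:M.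
  by rewrite -map_mxM PQ map_mx1.
rewrite -(det_conj _ _ _ _ _ _ EN PQ').
have -> : map_mx (@mpolyC m.+1 C) P *m pencil A *m map_mx (@mpolyC m.+1 C) Q
    = pencil Y.
  rewrite /pencil mulmxDr mulmxDl -scalemxAr -scalemxAl mulmx1 PQ'; congr (_ + _).
  rewrite mulmx_sumr mulmx_suml; apply: eq_bigr => i _.
  by rewrite -scalemxAr -scalemxAl -!map_mxM.
rewrite -[pencil Y]submxK.
have -> : dlsubmx (pencil Y) = 0.
  apply/matrixP => i j; rewrite !mxE summxE big1 ?addr0.
    by rewrite -val_eqE /= gtn_eqF ?mulr0 // ltn_addr.
  move=> l _; have /matrixP/(_ i j) := st _ (stA l).
  by rewrite !mxE => ->; rewrite mulr0.
have -> : ulsubmx (pencil Y) = pencil (fun i => ulsubmx (Y i)).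
  apply/matrixP => i j; rewrite !mxE !summxE (inj_eq (@lshift_inj _ _)).
  by congr (_ + _); apply: eq_bigr => l _; rewrite !mxE.
have -> : drsubmx (pencil Y) = pencil (fun i => drsubmx (Y i)).
  apply/matrixP => i j; rewrite !mxE !summxE (inj_eq (@rshift_inj _ _)).
  by congr (_ + _); apply: eq_bigr => l _; rewrite !mxE.
exact: det_ublock.
Qed.

(** The matrices preserving [U] form a space that contains 1 and is closed under right
    multiplication by the generators. *)
Lemma agenv_stable (F : fieldType) k n (A : n.-tuple 'M[F]_k.+1)
    (U : {vspace 'cV[F]_k.+1}) B :
  (forall (i : 'I_n) v, v \in U -> tnth A i *m v \in U) ->
  B \in agenv <<A>>%VS -> forall v, v \in U -> B *m v \in U.
Proof.
move=> stA BA v vU.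
pose L (w : 'cV[F]_k.+1) := linfun (mulmxr w : 'M[F]_k.+1 -> 'cV_k.+1).
(* Testing on a basis of [U] presents this stabiliser as a finite intersection of subspaces. *)
pose S := (\bigcap_(j < \dim U) (L (vbasis U)`_j @^-1: U))%VS.
have SP X : reflect (forall w, w \in U -> X *m w \in U) (X \in S).
  apply: (iffP idP) => [XS w wU|stX].
    rewrite (coord_vbasis wU) mulmx_sumr; apply: memv_suml => j _.
    rewrite -scalemxAr memvZ //; move: XS.
    by rewrite memvE => /subv_bigcapP/(_ j isT); rewrite -memvE -memv_preim lfunE.
  rewrite memvE; apply/subv_bigcapP => j _; rewrite -memvE -memv_preim lfunE /=.
  by apply: stX; rewrite vbasis_mem // mem_nth // size_tuple.
have AS : (<<A>> <= S)%VS.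
  by apply/span_subvP => X /tnthP[i ->]; apply/SP; apply: stA.
have: (agenv <<A>> <= S)%VS.
  apply: agenv_sub_modr.
    by rewrite -memvE; apply/SP => w; rewrite mul1mx.
  apply/prodvP => X Y /SP stX YA; apply/SP => w wU; rewrite -mulmxA.
  by apply: stX; apply: (elimT (SP Y)) wU; apply: (subvP AS).
by move/subvP/(_ _ BA)/SP; apply.
Qed.

(** * Choice of the extra matrix, and the equivalence *)

(** Scalar matrices preserve the line through the first unit vector, which is proper because the
    size is at least 2. *)
Lemma irreducible_tuple_nonscalar (R : realType) k n (A : n.-tuple 'M[R[i]]_k.+2) :
  irreducible_tuple A -> exists i, ~~ is_scalar_mx (tnth A i).
Proof.
move=> irrA; apply/existsP; apply: contraT => /existsPn scA.
pose e : 'cV[R[i]]_k.+2 := delta_mx 0 0.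
have e0 : e != 0.
  by apply/eqP => /matrixP/(_ 0 0)/eqP; rewrite !mxE !eqxx oner_eq0.
have [i v /vlineP[c ->]|E|E] := irrA <[e]>%VS.
- have /is_scalar_mxP[a ->] := negbNE (scA i).
  by rewrite mul_scalar_mx !memvZ ?memv_line.
- by have := memv_line e; rewrite E memv0 => /eqP e_0; rewrite e_0 eqxx in e0.
- have : delta_mx 1 0 \in <[e]>%VS by rewrite E memvf.
  by case/vlineP=> c /matrixP/(_ 1 0)/eqP; rewrite !mxE mulr0 oner_eq0.
Qed.

Lemma irreducible_tuple_generates (R : realType) k n (A : n.-tuple 'M[R[i]]_k.+1) B :
  irreducible_tuple A -> B \in generated_algebra A.
Proof.
move=> irrA; apply: (@burnside _ _ [aspace of agenv <<A>>%VS]) => [|U stU].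
  by rewrite memvE sub1_agenv.
apply: irrA => i v; apply: stU.
by rewrite /= (subvP (sub_agenv _)) // memv_span // mem_tnth.
Qed.

Lemma sum_rcons_mx (C : comNzRingType) k n (A : n.-tuple 'M[C]_k) B
    (f : 'I_n -> {poly C}) c :
  \sum_j (if unlift ord_max j is Some i then f i else c) *:
      map_mx polyC (tnth [tuple of rcons A B] j)
  = \sum_i f i *: map_mx polyC (tnth A i) + c *: map_mx polyC B.
Proof.
rewrite big_ord_recr /= unlift_none.
have -> : tnth [tuple of rcons A B] ord_max = B.
  by rewrite (tnth_nth 0) /= nth_rcons size_tuple ltnn eqxx.
congr (_ + _); apply: eq_bigr => i _.
have -> : widen_ord (leqnSn n) i = lift ord_max i.
  by apply: val_inj; rewrite [RHS]lift_max.
rewrite liftK; have -> // : tnth [tuple of rcons A B] (lift ord_max i) = tnth A i.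
by rewrite !(tnth_nth 0) lift_max nth_rcons size_tuple ltn_ord.
Qed.

Lemma char_poly_shift (C : idomainType) n : char_poly (- shift_mx C n) = 'X^(n.+1).
Proof.
rewrite char_poly_trig.
  rewrite (eq_bigr (fun=> 'X)) ?prodr_const ?card_ord // => i _.
  by rewrite !mxE ltn_eqF // oppr0 subr0.
apply/is_trig_mxP => i j ij; rewrite !mxE ltn_eqF ?oppr0 //.
exact: ltnW.
Qed.

Lemma exists_irreducible_extension (R : realType) k n (A : n.-tuple 'M[R[i]]_k.+1) :
  irreducible_tuple A ->
  exists B, irreducible_elt (pencil_det [tuple of rcons A B]).
Proof.
case: k A => [|k] A irrA.
  (* All 1 by 1 matrices are scalar; here [B = 1] specialises the determinant to z_0 + x. *)
  exists 1%:M.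
  pose h (j : 'I_n.+1) : {poly R[i]} := if unlift ord_max j is Some _ then 0 else 'X.
  apply: (@pencil_det_irreducible _ _ _ _ h 1).
  - rewrite sum_rcons_mx big1 ?add0r => [|i _]; last by rewrite scale0r.
    rewrite map_mxN map_mxZ /= /horner_eval hornerX scale0r oppr0.
    by rewrite /char_poly /char_poly_mx map_mx0 subr0 det_scalar expr1.
  - rewrite sum_rcons_mx big1 ?add0r => [|i _]; last by rewrite scale0r.
    by rewrite map_mx1 detZ det1.
  - by rewrite hornerC oner_eq0.
have [i0 /nonscalar_conj_corner[P Pu M0]] := irreducible_tuple_nonscalar _ _ _ _ irrA.
(* [B] is the shift in the basis where [tnth A i0] has a nonzero corner entry. *)
pose J := shift_mx R[i] k.+1; pose B := invmx P *m J *m P; exists B.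
pose h (j : 'I_n.+1) : {poly R[i]} :=
  if unlift ord_max j is Some i then (if i == i0 then 'X else 0) else 1.
have [g Eg g0] := det_shift_pencil _ _ (P *m tnth A i0 *m invmx P).
have sumE : \sum_j h j *: map_mx polyC (tnth [tuple of rcons A B] j)
    = 'X *: map_mx polyC (tnth A i0) + map_mx polyC B.
  rewrite sum_rcons_mx scale1r (bigD1 i0) //= eqxx big1 ?addr0 // => i /negPf ->.
  by rewrite scale0r.
have PBP : P *m B *m invmx P = J by rewrite /B !mulmxA mulmxV // mul1mx mulmxK.
apply: (@pencil_det_irreducible _ _ _ _ h g).
- rewrite sumE -char_poly_shift -/J -PBP -mulNmx -mulmxN char_poly_conj ?mulmxV //.
  congr char_poly; apply/matrixP => u v.
  by rewrite !mxE /horner_eval hornerN hornerD hornerM hornerX mul0r add0r hornerC.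
- have PQ : map_mx polyC P *m map_mx polyC (invmx P) = 1%:M.
    by rewrite -map_mxM mulmxV // map_mx1.
  rewrite sumE -(det_conj _ _ _ _ _ _ erefl PQ) -Eg; congr (\det _).
  by rewrite mulmxDr mulmxDl -scalemxAr -scalemxAl -!map_mxM PBP.
- by rewrite g0 mulf_neq0 // signr_eq0.
Qed.

Theorem theorem6p7 (R : realType) (k n : nat) (hn : (2 <= n)%N)
    (A : n.-tuple 'M[R[i]]_k.+1) :
  irreducible_tuple A <->
  exists2 B : 'M[R[i]]_k.+1,
    B \in generated_algebra A &
    irreducible_elt (pencil_det [tuple of rcons A B]).
Proof.
split=> [irrA|[B BA [_ _ irrB]] U stU].
  have [B irrB] := exists_irreducible_extension _ _ _ _ irrA.
  by exists B => //; apply: irreducible_tuple_generates.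
have stB (i : 'I_n.+1) v : v \in U -> tnth [tuple of rcons A B] i *m v \in U.
  have: tnth [tuple of rcons A B] i \in rcons A B by apply: mem_tnth.
  rewrite mem_rcons inE => /orP[/eqP ->|/tnthP[j ->]]; last exact: stU.
  exact: agenv_stable stU BA v.
have [U0|U0] := eqVneq (\dim U) 0%N.
  by left; apply/eqP; rewrite -dimv_eq0 U0.
have [e [A1 [A2 [EN Ep]]]] := det_pencil_stable _ _ _ _ _ stB.
(* A block of size 0 means [U] is everything; otherwise both blocks are nonempty and neither
   determinant is a unit. *)
case: e A2 EN Ep => [|e] A2 EN Ep.
  right; apply/eqP; rewrite eqEdim subvf dimvf /dim /= muln1 {1}EN addn0 leqnn //.
by case: (irrB _ _ Ep) => u; exfalso; move: u; apply/negP;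
  apply: det_pencil_nonunit; rewrite ?lt0n.
Qed.
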